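(* Let $R$ be a (commutative) $\mathbb Q$-algebra. The Lie algebra $CW_1$ over $R$ admits a one-dimensional universal central extension $\widetilde{CW}_1=CW_1\oplus R\mathbf c$, where the bracket is given by $$[G_r,\Gamma_s]=(r+s+1)\Gamma_{s-r+1}+\delta_{r,s+3}\binom{s+3}{3}\mathbf c$$ (with $\mathbf c$ central and the brackets $[G_r,G_s]$, $[\Gamma_r,\Gamma_s]$ as in $CW_1$). For $n\ge2$, $CW_n$ is centrally closed as a Lie algebra, i.e. it is its own universal central extension.
   Context: For $n\ge1$, the cohomological Witt algebra $CW_n$ over $R$ is the Lie algebra (no sign rules are used; it is an ordinary Lie algebra) of vector fields $\bigoplus_{a=1}^n\mathcal K^{\mathbf x}_{\mathrm{poly}}(R)\,\partial_{x_a}$, where $\mathcal K^{\mathbf x}_{\mathrm{poly}}(R)=R[x_1,\dots,x_n]\oplus\bigoplus_{\mathbf k\in\mathbb N^n}R\,\Omega^{\mathbf k}_{\mathbf x}$ has product $\mathbf x^{\mathbf j}\Omega^{\mathbf k}_{\mathbf x}=\Omega^{\mathbf k-\mathbf j}_{\mathbf x}$ if $\mathbf k\ge\mathbf j$ componentwise and $0$ otherwise, $\Omega^{\mathbf j}_{\mathbf x}\Omega^{\mathbf k}_{\mathbf x}=0$, and derivations $\partial_{x_a}\mathbf x^{\mathbf k}=k_a\mathbf x^{\mathbf k-\mathbf e_a}$, $\partial_{x_a}\Omega^{\mathbf k}_{\mathbf x}=-(k_a+1)\Omega^{\mathbf k+\mathbf e_a}_{\mathbf x}$. Explicitly, it is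 the free $R$-module with basis $G^a_{\mathbf r}=-\mathbf x^{\mathbf r}\partial_{x_a}$, $\Gamma^a_{\mathbf r}=-\Omega^{\mathbf r}_{\mathbf x}\partial_{x_a}$ ($\mathbf r\in\mathbb N^n$, $1\le a\le n$) and brackets $$[G^a_{\mathbf r},G^b_{\mathbf s}]=r_bG^a_{\mathbf r+\mathbf s-\mathbf e_b}-s_aG^b_{\mathbf r+\mathbf s-\mathbf e_a},\quad[\Gamma^a_{\mathbf r},\Gamma^b_{\mathbf s}]=0,\quad[G^a_{\mathbf r},\Gamma^b_{\mathbf s}]=r_b\Gamma^a_{\mathbf s-\mathbf r+\mathbf e_b}+(s_a+1)\Gamma^b_{\mathbf s-\mathbf r+\mathbf e_a},$$ where $G^a_{\mathbf r}=\Gamma^a_{\mathbf r}=0$ if $\mathbf r\not\ge\mathbf 0$. For $n=1$ write $G_r=G^1_r$, $\Gamma_r=\Gamma^1_r$. $\delta_{r,s}$ is the Kronecker delta. *)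

(* Defs.v *)
From HB Require Import structures.
From mathcomp Require Import all_boot all_order all_algebra.
From mathcomp Require Import ring.
From mathcomp.multinomials Require Import freeg mpoly.

Set Implicit Arguments.
Unset Strict Implicit.
Unset Printing Implicit Defensive.

Import GRing.Theory.
Local Open Scope ring_scope.

Section LieAlgebra.
Variable R : comNzRingType.

Record lie_axioms (V : lmodType R) (br : V -> V -> V) : Prop := LieAxioms {
  lie_axiom_linearl : forall y, linear (fun x => br x y);
  lie_axiom_linearr : forall x, linear (br x);
  lie_axiom_alternating : forall x, br x x = 0;
  lie_axiom_jacobi :
    forall x y z, br x (br y z) + br y (br z x) + br z (br x y) = 0 }.

Record lieAlgebra := LieAlgebra {
  lie_sort :> lmodType R;
  lie : lie_sort -> lie_sort -> lie_sort;
  lie_axiomsP : lie_axioms lie }.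

Definition lie_morphism (L M : lieAlgebra) (f : L -> M) : Prop :=
  forall x y, f (lie x y) = lie (f x) (f y).

Definition central_extension (E L : lieAlgebra) (p : {linear E -> L}) : Prop :=
  [/\ lie_morphism p,
      forall y, exists x, p x = y
    & forall z, p z = 0 -> forall x, lie z x = 0].

Definition universal_central_extension (E L : lieAlgebra)
    (p : {linear E -> L}) : Prop :=
  central_extension p /\
  forall (E' : lieAlgebra) (p' : {linear E' -> L}), central_extension p' ->
  exists f : {linear E -> E'},
    (lie_morphism f /\ forall x, p' (f x) = p x) /\
    forall g : {linear E -> E'},
      lie_morphism g -> (forall x, p' (g x) = p x) -> g =1 f.

(* L, with the identity map, is its own universal central extension. *)
Definition centrally_closed (L : lieAlgebra) : Prop :=
  @universal_central_extension L L idfun.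

End LieAlgebra.

Section Kpoly.
Variables (R : comNzRingType) (n : nat).
Implicit Types (p q : {mpoly R[n]}) (w : {freeg 'X_{1..n} / R}).
Implicit Types (j k r s : 'X_{1..n}) (a b : 'I_n).

Local Notation Omega := {freeg 'X_{1..n} / R}.

(* fglift F is the R-linear extension of F to finite formal sums.  A polynomial
   coerces to the formal sum of its monomials, so this is the bilinear
   extension of x^j * Omega^k = Omega^(k - j) (0 unless j <= k). *)
Definition omega_act p w : Omega :=
  fglift (fun j => fglift
    (fun k => if (j <= k)%MM then << (k - j)%MM >> else 0 : Omega) w) p.

Definition omega_deriv a w : Omega :=
  fglift (fun k => - ((k a).+1%:R *: << (k + U_(a))%MM >>) : Omega) w.

(* R[x_1, ..., x_n] (+) (+)_k R Omega^k.  The alias keeps its product apart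
   from the componentwise product on pairs. *)
Definition kpoly : Type := ({mpoly R[n]} * Omega)%type.

HB.instance Definition _ := GRing.Lmodule.on kpoly.

Implicit Types f g h : kpoly.

Definition kpoly_one : kpoly := (1, 0).
Definition kpoly_mul f g : kpoly :=
  (f.1 * g.1, omega_act f.1 g.2 + omega_act g.1 f.2).

Definition kderiv a f : kpoly := (f.1^`M(a), omega_deriv a f.2).



HB.instance Definition _ (M : lmodType R) (F : 'X_{1..n} -> M) :=
  GRing.isAdditive.Build Omega M (fglift F) (lift_is_additive F).

Fact fgliftE (M : lmodType R) (F : 'X_{1..n} -> M) (D : Omega) :
  fglift F D = \sum_(k <- dom D) coeff k D *: F k.
Proof.
rewrite -{1}[D]freeg_sumE raddf_sum.
by apply: eq_bigr => k _; rewrite /= liftU.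
Qed.

Fact fglift_linear (M : lmodType R) (F : 'X_{1..n} -> M) :
  linear (fglift F : Omega -> M).
Proof.
move=> c D D'; rewrite raddfD; congr (_ + _).
rewrite [in RHS]fgliftE /= [c *: D]/(freeg.fgscale c D) raddf_sum scaler_sumr.
by apply: eq_bigr => k _; rewrite /= liftU scalerA.
Qed.

Fact omega_act_linearr p : linear (omega_act p).
Proof.
move=> c w w'; rewrite /omega_act !fgliftE scaler_sumr -big_split /=.
by apply: eq_bigr => j _; rewrite fglift_linear scalerDr !scalerA mulrC.
Qed.

Fact omega_act_linearl w : linear (omega_act^~ w).
Proof. by move=> c p q; rewrite /omega_act -fglift_linear. Qed.

Fact omega_deriv_linear a : linear (omega_deriv a).
Proof. exact: fglift_linear. Qed.

HB.instance Definition _ p := GRing.isLinear.Build R Omega Omega *:%R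
  (omega_act p) (omega_act_linearr p).
HB.instance Definition _ a := GRing.isLinear.Build R Omega Omega *:%R
  (omega_deriv a) (omega_deriv_linear a).

Fact linear_map0 (U V : lmodType R) (A : U -> V) : linear A -> A 0 = 0.
Proof. by move/(_ (-1) 0 0); rewrite scaler0 addr0 scaleN1r addNr. Qed.

Fact omega_actDl w p q : omega_act (p + q) w = omega_act p w + omega_act q w.
Proof. by have := omega_act_linearl w 1 p q; rewrite !scale1r. Qed.

Fact omega_actZl w c p : omega_act (c *: p) w = c *: omega_act p w.
Proof.
have := omega_act_linearl w c p 0.
by rewrite (linear_map0 (omega_act_linearl w)) !addr0.
Qed.

Fact freegZU (c : R) k : << c *g k >> = c *: << k >> :> Omega.
Proof. by apply/eqP/freeg_eqP => z; rewrite coeffZ !coeffU mul1r. Qed.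

Lemma omega_actX j k :
  omega_act 'X_[j] << k >> = if (j <= k)%MM then << (k - j)%MM >> else 0.
Proof.
by rewrite /omega_act unlock /mpolyX_def /= liftU scale1r liftU scale1r.
Qed.

Lemma omega_derivU a k :
  omega_deriv a << k >> = - ((k a).+1%:R *: << (k + U_(a))%MM >>).
Proof. by rewrite /omega_deriv liftU scale1r. Qed.

Fact omega_ext (A B : Omega -> Omega) : linear A -> linear B ->
  (forall k, A << k >> = B << k >>) -> A =1 B.
Proof.
move=> lA lB AB w; elim/freeg_ind_dom0: w => [|c k w _ _ IH].
  by rewrite !linear_map0.
by rewrite freegZU lA lB AB IH.
Qed.

Fact mpoly_ext (A B : {mpoly R[n]} -> Omega) : linear A -> linear B ->
  (forall j, A 'X_[j] = B 'X_[j]) -> A =1 B.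
Proof.
move=> lA lB AB p; elim/mpolyind: p => [|c j p _ _ IH].
  by rewrite !linear_map0.
by rewrite lA lB AB IH.
Qed.

Fact omega_act1 w : omega_act 1 w = w.
Proof.
move: w; apply: omega_ext => [||k].
- exact: omega_act_linearr.
- by [].
have H : (0 <= k)%MM by apply/mnm_lepP => i; rewrite mnm0E.
by rewrite -mpolyX0 omega_actX H subm0.
Qed.

Fact omega_actA p q w : omega_act (p * q) w = omega_act p (omega_act q w).
Proof.
have act_lin p' := omega_act_linearr p'.
move: w; apply: omega_ext => [|c w w'|k]; first exact: act_lin.
  by rewrite !act_lin.
move: p; apply: mpoly_ext => [c p p'||i].
- by rewrite mulrDl -scalerAl omega_act_linearl.
- exact: omega_act_linearl.
move: q; apply: mpoly_ext => [c q q'|c q q'|j].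
- by rewrite mulrDr -scalerAr omega_act_linearl.
- by rewrite omega_act_linearl act_lin.
rewrite -mpolyXD !omega_actX; case: ifPn => [/mnm_lepP ijk|nijk].
  have jk : (j <= k)%MM.
    apply/mnm_lepP => t; have := ijk t.
    by rewrite mnmDE; apply/leq_trans/leq_addl.
  have ikj : (i <= k - j)%MM.
    apply/mnm_lepP => t; have := ijk t.
    by rewrite mnmDE mnmBE leq_subRL 1?addnC // (mnm_lepP jk).
  rewrite jk omega_actX ikj; congr << _ >>.
  by apply/mnmP => t; rewrite !mnmBE mnmDE addnC subnDA.
case: ifP => [/mnm_lepP jk|_]; last by rewrite linear0.
rewrite omega_actX ifN //; apply: contra nijk => /mnm_lepP ikj.
apply/mnm_lepP => t; have := ikj t.
by rewrite mnmDE mnmBE leq_subRL // addnC.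
Qed.

Fact mnm_leBU a j k : (j - U_(a) <= k)%MM = (j <= k + U_(a))%MM.
Proof.
by apply/mnm_lepP/mnm_lepP => H t; have := H t;
  rewrite mnmBE mnmDE mnm1E leq_subLR addnC.
Qed.

Fact mnm_subBU a j k : (0 < j a)%N -> (k - (j - U_(a)) = k + U_(a) - j)%MM.
Proof.
move=> j_gt0; apply/mnmP => t; rewrite !(mnmBE, mnmDE, mnm1E) subnBA //.
by case: eqP => [<-|].
Qed.

Fact omega_derivM a p w :
  omega_deriv a (omega_act p w) =
  omega_act p^`M(a) w + omega_act p (omega_deriv a w).
Proof.
move: w; apply: omega_ext => [c w w'|c w w'|k].
- by rewrite !linearP.
- by rewrite !linearP scalerDr addrACA.
move: p; apply: mpoly_ext => [c p p'|c p p'|j].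
- by rewrite omega_act_linearl linearP.
- by rewrite linearP !omega_act_linearl scalerDr addrACA.
rewrite mderivX omega_actZl omega_derivU linearN linearZ /= !omega_actX.
have [j0|j_gt0] := posnP (j a).
  rewrite j0 scale0r add0r.
  have -> : (j <= k + U_(a))%MM = (j <= k)%MM.
    apply/mnm_lepP/mnm_lepP => H t; have := H t; rewrite mnmDE mnm1E.
      by case: eqP => [<-|_]; rewrite ?j0 ?addn0.
    by move=> ?; rewrite (leq_trans (H t)) ?leq_addr.
  case: ifP => jk; last by rewrite linear0 scaler0 oppr0.
  rewrite omega_derivU mnmBE j0 subn0; congr (- (_ *: << _ >>)).
  apply/mnmP => t; rewrite !(mnmBE, mnmDE, mnm1E).
  by rewrite addnBAC // (mnm_lepP jk).
rewrite mnm_leBU (mnm_subBU _ j_gt0).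
case: ifP => [/mnm_lepP jk|jk].
  case: (boolP (j <= k + U_(a))%MM) => [_|/negP[]]; last first.
    by apply/mnm_lepP => t; rewrite mnmDE (leq_trans (jk t)) ?leq_addr.
  rewrite omega_derivU mnmBE -scaleNr -scaleNr -scalerDl.
  have -> : (k - j + U_(a) = k + U_(a) - j)%MM.
    by apply/mnmP => t; rewrite !(mnmBE, mnmDE, mnm1E) addnBAC.
  by congr (_ *: _); rewrite -subSn // natrB ?opprB // (leq_trans (jk a)).
rewrite linear0; case: ifP => jk'; last by rewrite !scaler0 oppr0 addr0.
suff -> : j a = (k a).+1 by rewrite subrr.
apply/eqP; rewrite eqn_leq; have := mnm_lepP jk' a.
rewrite mnmDE mnm1E eqxx addn1 => -> /=; rewrite ltnNge.
apply/negP => H; move/negP: jk; apply; apply/mnm_lepP => t.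
by have := mnm_lepP jk' t; rewrite mnmDE mnm1E; case: eqP => [<-|_]; rewrite ?addn0.
Qed.

Fact omega_derivC a b w :
  omega_deriv a (omega_deriv b w) = omega_deriv b (omega_deriv a w).
Proof.
move: w; apply: omega_ext => [c w w'|c w w'|k]; rewrite ?linearP //.
rewrite !omega_derivU !linearN !linearZ /= !omega_derivU !scalerN !scalerA.
congr (- - (_ *: << _ >>)); last by rewrite -!addmA [(U_(a) + _)%MM]addmC.
rewrite -!natrM !mnmDE !mnm1E eq_sym; case: eqP => [->|_]; first by [].
by rewrite !addn0 mulnC.
Qed.

Fact kpoly_mulA : associative kpoly_mul.
Proof.
move=> f g h; congr pair; first exact: mulrA.
by rewrite /= !linearD /= -!omega_actA -addrA [h.1 * f.1]mulrC [h.1 * g.1]mulrC.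
Qed.

Fact kpoly_mulC : commutative kpoly_mul.
Proof. by move=> f g; congr pair; rewrite (mulrC, addrC). Qed.

Fact kpoly_mul1 : left_id kpoly_one kpoly_mul.
Proof. by case=> p w; congr pair; rewrite /= ?mul1r // linear0 omega_act1 addr0. Qed.

Fact kpoly_mulDl : left_distributive kpoly_mul +%R.
Proof.
move=> f g h; congr pair; rewrite /= ?mulrDl //.
by rewrite omega_actDl linearD addrACA.
Qed.

Fact kpoly_1_neq0 : kpoly_one != 0.
Proof. by apply/eqP => /(congr1 fst) /eqP; rewrite /= oner_eq0. Qed.

HB.instance Definition _ := GRing.Zmodule_isComNzRing.Build kpoly
  kpoly_mulA kpoly_mulC kpoly_mul1 kpoly_mulDl kpoly_1_neq0.

Fact kpoly_scaleAl (c : R) f g : c *: (f * g) = (c *: f) * g.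
Proof.
congr pair; rewrite /= ?scalerAl //.
by rewrite omega_actZl linearZ scalerDr.
Qed.

HB.instance Definition _ :=
  GRing.Lmodule_isLalgebra.Build R kpoly kpoly_scaleAl.
HB.instance Definition _ := GRing.Lalgebra_isComAlgebra.Build R kpoly.

Fact kderiv_linear a : linear (kderiv a).
Proof. by move=> c f g; congr pair; rewrite /= linearP. Qed.

HB.instance Definition _ a := GRing.isLinear.Build R kpoly kpoly *:%R
  (kderiv a) (kderiv_linear a).

Lemma kderivM a f g : kderiv a (f * g) = kderiv a f * g + f * kderiv a g.
Proof.
have E (A B C D : Omega) : A + B + (C + D) = A + D + (B + C).
  by rewrite [C + D]addrC addrACA.
congr pair; first exact: mderivM.
by rewrite linearD /= !omega_derivM E.
Qed.

Lemma kderivC a b f : kderiv a (kderiv b f) = kderiv b (kderiv a f).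
Proof. by congr pair; [exact: mderiv_comm | exact: omega_derivC]. Qed.

Definition xmon r : kpoly := ('X_[r], 0).
Definition Omon r : kpoly := (0, << r >>).

Lemma mul_xx j k : xmon j * xmon k = xmon (j + k)%MM.
Proof. by congr pair; rewrite /= ?mpolyXD // !linear0 addr0. Qed.

Lemma mul_xO j k :
  xmon j * Omon k = if (j <= k)%MM then Omon (k - j)%MM else 0.
Proof.
rewrite [LHS]/(kpoly_mul _ _) /kpoly_mul /= mulr0 linear0 addr0 omega_actX.
by case: ifP.
Qed.

Lemma mul_OO j k : Omon j * Omon k = 0.
Proof.
rewrite [LHS]/(kpoly_mul _ _) /kpoly_mul /= mulr0.
by rewrite !(linear_map0 (omega_act_linearl _)) addr0.
Qed.

Lemma kderiv_x a k : kderiv a (xmon k) = (k a)%:R *: xmon (k - U_(a))%MM.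
Proof. by congr pair; rewrite /= ?mderivX // !linear0. Qed.

Lemma kderiv_O a k :
  kderiv a (Omon k) = - ((k a).+1%:R *: Omon (k + U_(a))%MM).
Proof. by congr pair; rewrite /= ?omega_derivU // linear0 scaler0 oppr0. Qed.

End Kpoly.

Section CW.
Variables (R : comNzRingType) (n : nat).
Implicit Types (a b : 'I_n) (r s : 'X_{1..n}).

(* X represents the vector field \sum_a X a * d/dx_a. *)
Definition vfield : lmodType R := {ffun 'I_n -> kpoly R n}.

Implicit Types (X Y Z : vfield) (f g : kpoly R n).

Definition vf_act X f : kpoly R n := \sum_a X a * kderiv a f.

(* The commutator of X and Y as derivations; see vf_bracket_act. *)
Definition vf_bracket X Y : vfield :=
  [ffun b => vf_act X (Y b) - vf_act Y (X b)].

Fact vf_act_linearr X : linear (vf_act X).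
Proof.
move=> c f g; rewrite scaler_sumr -big_split; apply: eq_bigr => a _.
by rewrite linearP mulrDr scalerAr.
Qed.

HB.instance Definition _ X := GRing.isLinear.Build R (kpoly R n) (kpoly R n)
  *:%R (vf_act X) (vf_act_linearr X).

Fact vf_act_linearl f : linear (vf_act^~ f).
Proof.
move=> c X Y; rewrite scaler_sumr -big_split; apply: eq_bigr => a _.
by rewrite !ffunE mulrDl scalerAl.
Qed.

Fact vf_bracket_act X Y f :
  vf_act (vf_bracket X Y) f = vf_act X (vf_act Y f) - vf_act Y (vf_act X f).
Proof.
have E Z W : vf_act Z (vf_act W f) = \sum_b vf_act Z (W b) * kderiv b f +
    \sum_a \sum_b Z a * W b * kderiv a (kderiv b f).
  have D a : kderiv a (vf_act W f) = \sum_b (kderiv a (W b) * kderiv b f +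
      W b * kderiv a (kderiv b f)).
    by rewrite linear_sum; apply: eq_bigr => b _; exact: kderivM.
  rewrite [LHS](eq_bigr _ (fun a _ => congr1 (GRing.mul (Z a)) (D a))).
  under eq_bigr do rewrite big_split mulrDr /= !mulr_sumr.
  rewrite big_split /= exchange_big; congr (_ + _).
    by apply: eq_bigr => b _; rewrite mulr_suml; apply: eq_bigr => a _; rewrite mulrA.
  by apply: eq_bigr => a _; apply: eq_bigr => b _; rewrite mulrA.
have C : \sum_a \sum_b X a * Y b * kderiv a (kderiv b f) =
         \sum_a \sum_b Y a * X b * kderiv a (kderiv b f).
  rewrite exchange_big; apply: eq_bigr => a _; apply: eq_bigr => b _.
  by rewrite kderivC [X b * _]mulrC.
rewrite !E C opprD addrACA subrr addr0 -sumrB.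
by apply: eq_bigr => b _; rewrite ffunE mulrBl.
Qed.

Fact vf_bracket_axioms : lie_axioms vf_bracket.
Proof.
split.
- move=> Y c X X'; apply/ffunP => b; rewrite !ffunE linearP vf_act_linearl.
  by rewrite scalerBr opprD addrACA.
- move=> X c Y Y'; apply/ffunP => b; rewrite !ffunE linearP vf_act_linearl.
  by rewrite scalerBr opprD addrACA.
- by move=> X; apply/ffunP => b; rewrite !ffunE subrr.
have brE X Y b : vf_bracket X Y b = vf_act X (Y b) - vf_act Y (X b).
  by rewrite ffunE.
have addE (X Y : vfield) b : (X + Y) b = X b + Y b by rewrite ffunE.
move=> X Y Z; apply/ffunP => b; rewrite [RHS]ffunE !addE !brE !vf_bracket_act.
rewrite !raddfB /=; ring.
Qed.

Definition CW : lieAlgebra R := LieAlgebra vf_bracket_axioms.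

(* The vector field f d/dx_a. *)
Definition vf_dx f a : CW := [ffun b => f *+ (b == a)].

Definition CW_G a r : CW := - vf_dx (xmon R r) a.
Definition CW_Gamma a r : CW := - vf_dx (Omon R r) a.

Fact vf_dx_linear a : linear (vf_dx^~ a).
Proof.
by move=> c f g; apply/ffunP => b; rewrite !ffunE mulrnDl scalerMnr.
Qed.

Fact vf_actN X f : vf_act (- X) f = - vf_act X f.
Proof. by rewrite -sumrN; apply: eq_bigr => a _; rewrite ffunE mulNr. Qed.

Fact vf_act_dx f g a : vf_act (vf_dx f a) g = f * kderiv a g.
Proof.
rewrite /vf_act (bigD1 a) //= big1 => [|b /negPf nab].
  by rewrite ffunE eqxx addr0.
by rewrite ffunE nab mul0r.
Qed.

Lemma lie_dx f g a b : lie (- vf_dx f a) (- vf_dx g b) =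
  vf_dx (f * kderiv a g) b - vf_dx (g * kderiv b f) a.
Proof.
apply/ffunP => c; rewrite [LHS]ffunE !vf_actN !vf_act_dx.
rewrite ![(- _ : vfield) c]ffunE [RHS]ffunE [(- _ : vfield) c]ffunE !ffunE.
by rewrite !raddfN !raddfMn /= !mulNrn !mulrN !mulrnAr !opprK.
Qed.

Fact vf_dx0 a : vf_dx 0 a = 0.
Proof. exact: linear_map0 (vf_dx_linear a). Qed.

Fact vf_dxN f a : vf_dx (- f) a = - vf_dx f a.
Proof. by have := vf_dx_linear a (-1) f 0; rewrite !scaleN1r vf_dx0 !addr0. Qed.

Fact vf_dxZ c f a : vf_dx (c *: f) a = c *: vf_dx f a.
Proof. by have := vf_dx_linear a c f 0; rewrite vf_dx0 !addr0. Qed.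

Fact mul_xdx a r s : xmon R r * kderiv a (xmon R s) =
  (s a)%:R *: xmon R (r + s - U_(a))%MM.
Proof.
rewrite kderiv_x -scalerAr mul_xx; have [->|sa] := posnP (s a).
  by rewrite !scale0r.
congr (_ *: xmon R _); apply/mnmP => t; rewrite !(mnmDE, mnmBE, mnm1E).
by rewrite addnBA //; case: eqP => [<-|].
Qed.

Lemma lie_GG a b r s : lie (CW_G a r) (CW_G b s) =
  (r b)%:R *: CW_G a (r + s - U_(b))%MM - (s a)%:R *: CW_G b (r + s - U_(a))%MM.
Proof.
by rewrite lie_dx !mul_xdx [(s + r)%MM]addmC !vf_dxZ !scalerN opprK addrC.
Qed.

Lemma lie_GammaGamma a b r s : lie (CW_Gamma a r) (CW_Gamma b s) = 0.
Proof.
rewrite lie_dx !kderiv_O !mulrN -!scalerAr !mul_OO.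
by rewrite !scaler0 oppr0 !vf_dx0 subrr.
Qed.

(* Gamma^b_(t - r), read as 0 unless r <= t. *)
Definition CW_GammaB b t r : CW :=
  if (r <= t)%MM then CW_Gamma b (t - r)%MM else 0.

Lemma lie_GGamma a b r s : lie (CW_G a r) (CW_Gamma b s) =
  (r b)%:R *: CW_GammaB a (s + U_(b))%MM r +
  (s a).+1%:R *: CW_GammaB b (s + U_(a))%MM r.
Proof.
have dxB c t : vf_dx (if (r <= t)%MM then Omon R (t - r)%MM else 0) c
    = - CW_GammaB c t r.
  by rewrite /CW_GammaB; case: ifP => _; rewrite ?opprK // vf_dx0 oppr0.
rewrite lie_dx kderiv_O mulrN -scalerAr mul_xO vf_dxN vf_dxZ dxB scalerN opprK.
suff -> : vf_dx (Omon R s * kderiv b (xmon R r)) a =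
    - ((r b)%:R *: CW_GammaB a (s + U_(b))%MM r) by rewrite opprK [RHS]addrC.
rewrite kderiv_x -scalerAr vf_dxZ.
have [->|rb] := posnP (r b); first by rewrite !scale0r oppr0.
by rewrite [Omon _ _ * _]mulrC mul_xO mnm_leBU mnm_subBU // dxB scalerN.
Qed.

End CW.

Definition CW1_G (R : comNzRingType) (r : nat) : CW R 1 :=
  CW_G R ord0 [multinom r | i < 1].

(* Indexed by int so that Gamma_k = 0 for k < 0. *)
Definition CW1_Gamma (R : comNzRingType) (k : int) : CW R 1 :=
  if k is Posz s then CW_Gamma R ord0 [multinom s | i < 1] else 0.

Lemma lie_CW1_GGamma (R : comNzRingType) (r s : nat) :
  lie (CW1_G R r) (CW1_Gamma R s) =
  (r + s + 1)%:R *: CW1_Gamma R (s%:Z - r%:Z + 1).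
Proof.
rewrite lie_GGamma -scalerDl !mnmE -natrD addn1 -addnS; congr (_ *: _).
rewrite /CW_GammaB /CW1_Gamma.
have -> : ([multinom r | _ < 1] <= [multinom s | _ < 1] + U_(ord0))%MM = (r <= s.+1)%N.
  apply/mnm_lepP/idP => [/(_ ord0)|H i]; rewrite !mnmE ?ord1 ?eqxx ?addn1 //.
have -> : s%:Z - r%:Z + 1 = s.+1%:Z - r%:Z by rewrite -addrA [- _ + 1]addrC addrA -PoszD addn1.
case: leqP => [rs|sr].
  rewrite subzn //; congr (CW_Gamma R ord0 _); apply/mnmP => i.
  have -> : i = ord0 by rewrite ord1.
  by rewrite mnmBE mnmDE !mnmE eqxx addn1.
have -> : s.+1%:Z - r%:Z = - (r - s.+1)%N%:Z by rewrite -subzn ?opprB // ltnW.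
by rewrite -[(r - s.+1)%N]prednK ?subn_gt0.
Qed.

(* Main.v *)
Require Import Defs.
From HB Require Import structures.
From mathcomp Require Import all_boot all_order all_algebra.
From mathcomp Require Import ring zify.
From mathcomp.multinomials Require Import freeg mpoly.

Set Implicit Arguments.
Unset Strict Implicit.
Unset Printing Implicit Defensive.

Import GRing.Theory.
Local Open Scope ring_scope.

(** Let [p : E -> L] be a central extension with [E] perfect.  Any other central
extension [p' : E' -> L] pulls the bracket of [E'] back to a bilinear map
[b (x, y) = [s x, s y]] on [L], where [s] is an arbitrary set-theoretic section
of [p']: as the kernel of [p'] is central, [b] does not depend on [s], so it is
a 2-cocycle on [L] even though [s] is not linear.  A morphism [E -> E'] over [L]
is the same thing as a linear map [F] with [F [x, y] = b (p x, p y)], and it is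
unique because [E] is perfect.  So [p] is universal as soon as every 2-cocycle
on [L], with values in any module, factors in this way through the bracket of
[E] ([universal_central_extensionI]).

For [L = CW_n] the torus spanned by the [T_j = G^j_(e_j)] acts diagonally on the
basis.  The cocycle identity with one argument in the torus says that
[lambda_j b (x, y) = b (T_j, [x, y])] when [x] and [y] are weight vectors of
total weight [lambda].  After subtraction of a coboundary, [b] vanishes on the
torus and on the pairs [(G^a_0, G^a_(2 e_a))] ([cocycle_normalise]), hence, over
the rationals, on all pairs of nonzero total weight.  The finitely many pairs
[(G^a_r, G^c_s)] of total weight zero only involve vector fields of polynomial
degree at most two and reduce to the normalised ones, and no two [Gamma]'s have
opposite weights.

There remain the pairs [(G^a_r, Gamma^c_k)] with [r = k + (1, ..., 1) + e_a + e_c],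
whose bracket is zero ([cocycle_coboundary]).
- If [n >= 2], then [G^a_r] is a multiple of a bracket of two elements that both
  commute with [Gamma^c_k], so [b] vanishes there
  ([cocycle_GGamma_opposite]).
- If [n = 1], the bracket with [G_0 = - d/dx] gives a recursion with solution
  [b (G_(k+3), Gamma_k) = C(k+3, 3) b (G_3, Gamma_0)]
  ([cocycle_CW1_opposite]).  So [b] is, up to a coboundary, a multiple of the
  cocycle [Res (f''' g) / 6], of the type of Gelfand-Fuchs and Virasoro; that
  this is a cocycle follows from integration by parts, the residue (the
  coefficient of [Omega^0]) being zero on derivatives. *)

(** * Cocycles and universal central extensions *)

Section Cocycles.
Variable R : comNzRingType.
Implicit Types (L : lieAlgebra R) (M V : lmodType R).

(** The values are in a module with trivial action.  The fields repeat those of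
[lie_axioms], so that the bracket of a Lie algebra is itself a cocycle. *)
Record cocycle L M (b : L -> L -> M) : Prop := Cocycle {
  cocycle_linl : forall y, linear (fun x => b x y);
  cocycle_linr : forall x, linear (b x);
  cocycle_alt : forall x, b x x = 0;
  cocycle_cyclic :
    forall x y z, b x (lie y z) + b y (lie z x) + b z (lie x y) = 0 }.

Lemma lie_cocycle L : cocycle (@lie R L).
Proof. by case: (lie_axiomsP L). Qed.

Lemma linear_mapD M V (f : M -> V) : linear f -> {morph f : x y / x + y}.
Proof. by move=> lf x y; have := lf 1 x y; rewrite !scale1r. Qed.

Lemma linear_mapZ M V (f : M -> V) : linear f ->
  forall c, {morph f : x / c *: x}.
Proof. by move=> lf c x; have := lf c x 0; rewrite (linear_map0 lf) !addr0. Qed.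

Lemma linear_mapN M V (f : M -> V) : linear f -> {morph f : x / - x}.
Proof. by move=> lf x; rewrite -scaleN1r (linear_mapZ lf) scaleN1r. Qed.

Lemma linear_mapB M V (f : M -> V) : linear f -> {morph f : x y / x - y}.
Proof. by move=> lf x y; rewrite (linear_mapD lf) (linear_mapN lf). Qed.

Lemma cocycle_comp L M V (b : L -> L -> M) (f : M -> V) :
  cocycle b -> linear f -> cocycle (fun x y => f (b x y)).
Proof.
move=> [ll lr ba bc] lf; split.
- by move=> y c x x'; rewrite ll lf.
- by move=> x c y y'; rewrite lr lf.
- by move=> x; rewrite ba (linear_map0 lf).
- by move=> x y z; rewrite -!(linear_mapD lf) bc (linear_map0 lf).
Qed.

Lemma cocycleB L M (b c : L -> L -> M) :
  cocycle b -> cocycle c -> cocycle (fun x y => b x y - c x y).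
Proof.
move=> [ll lr ba bc] [ll' lr' ba' bc']; split.
- by move=> y k x x'; rewrite ll ll' scalerBr opprD addrACA.
- by move=> x k y y'; rewrite lr lr' scalerBr opprD addrACA.
- by move=> x; rewrite ba ba' subrr.
- move=> x y z; rewrite [X in X + _]addrACA -opprD addrACA -opprD.
  by rewrite bc bc' subrr.
Qed.

Section Theory.
Variables (L : lieAlgebra R) (M : lmodType R) (b : L -> L -> M).
Hypothesis cb : cocycle b.

Lemma cocycle0l y : b 0 y = 0.
Proof. exact: linear_map0 (cocycle_linl cb y). Qed.

Lemma cocycle0r x : b x 0 = 0.
Proof. exact: linear_map0 (cocycle_linr cb x). Qed.

Lemma cocycleBl y : {morph b^~ y : x x' / x - x'}.
Proof. exact: linear_mapB (cocycle_linl cb y). Qed.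

Lemma cocycleBr x : {morph b x : y y' / y - y'}.
Proof. exact: linear_mapB (cocycle_linr cb x). Qed.

Lemma cocycleNl y : {morph b^~ y : x / - x}.
Proof. exact: linear_mapN (cocycle_linl cb y). Qed.

Lemma cocycleNr x : {morph b x : y / - y}.
Proof. exact: linear_mapN (cocycle_linr cb x). Qed.

Lemma cocycleZl y c : {morph b^~ y : x / c *: x}.
Proof. exact: linear_mapZ (cocycle_linl cb y) c. Qed.

Lemma cocycleZr x c : {morph b x : y / c *: y}.
Proof. exact: linear_mapZ (cocycle_linr cb x) c. Qed.

Lemma cocycleC x y : b x y = - b y x.
Proof.
apply/eqP; rewrite -addr_eq0; apply/eqP; have := cocycle_alt cb (x + y).
rewrite (linear_mapD (cocycle_linl cb _)) !(linear_mapD (cocycle_linr cb _)).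
by rewrite !(cocycle_alt cb) add0r addr0.
Qed.

End Theory.

Lemma cocycle_leibniz L M (b : L -> L -> M) : cocycle b ->
  forall x y z, b x (lie y z) = b (lie x y) z + b y (lie x z).
Proof.
move=> cb x y z; have /eqP := cocycle_cyclic cb x y z.
rewrite -addrA addr_eq0 => /eqP ->.
rewrite (cocycleC (lie_cocycle L) z x) (cocycleNr cb) (cocycleC cb z).
by rewrite -opprD opprK addrC.
Qed.

Definition extension_bracket L M (b : L -> L -> M) (x y : L * M) : L * M :=
  (lie x.1 y.1, b x.1 y.1).

Lemma extension_axioms L M (b : L -> L -> M) :
  cocycle b -> lie_axioms (extension_bracket b).
Proof.
have [ll lr ba bc] := lie_cocycle L => -[ll' lr' ba' bc']; split.
- by move=> y c x x'; congr pair; rewrite /= ?ll ?ll'.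
- by move=> x c y y'; congr pair; rewrite /= ?lr ?lr'.
- by move=> x; congr pair; rewrite /= ?ba ?ba'.
- by move=> x y z; congr pair; rewrite /= ?bc ?bc'.
Qed.

(** Perfectness in its universal form: brackets detect linear maps. *)
Definition bracket_spanned L : Prop :=
  forall V (f g : L -> V), linear f -> linear g ->
    (forall x y, f (lie x y) = g (lie x y)) -> f =1 g.

(** The section [s] is only a choice function.  Centrality of the kernel makes
[[s x, s y]] depend on [x] and [y] alone ([lieE]), which is why it is bilinear
and satisfies the cocycle identity. *)
Lemma universal_central_extensionI (E L : lieAlgebra R) (p : {linear E -> L}) :
  central_extension p -> bracket_spanned E ->
  (forall M (b : L -> L -> M), cocycle b ->
     exists2 F : E -> M, linear F & forall x y, F (lie x y) = b (p x) (p y)) ->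
  universal_central_extension p.
Proof.
move=> cp spanE factor; split=> // E' p' [p'L p'S p'Z].
have exs y : exists x, p' x == y by have [x <-] := p'S y; exists x.
pose s y := xchoose (exs y).
have sK y : p' (s y) = y by apply/eqP/(xchooseP (exs y)).
have cE := lie_cocycle E'.
have lieE x x' y y' : p' x = p' x' -> p' y = p' y' -> lie x y = lie x' y'.
  move=> xx' yy'; apply: (@etrans _ _ (lie x' y)); apply/eqP.
    rewrite -subr_eq0 -(cocycleBl cE); apply/eqP/p'Z.
    by rewrite linearB /= xx' subrr.
  rewrite -subr_eq0 -(cocycleBr cE) (cocycleC cE) oppr_eq0; apply/eqP/p'Z.
  by rewrite linearB /= yy' subrr.
have cb : cocycle (fun x y => lie (s x) (s y)).
  split.
  - by move=> y c x x'; rewrite -(cocycle_linl cE); apply: lieE;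
      rewrite ?linearP /= ?sK.
  - by move=> x c y y'; rewrite -(cocycle_linr cE); apply: lieE;
      rewrite ?linearP /= ?sK.
  - by move=> x; rewrite (cocycle_alt cE).
  - move=> x y z; rewrite -[RHS](cocycle_cyclic cE (s x) (s y) (s z)).
    by congr (_ + _ + _); apply: lieE; rewrite ?p'L ?sK.
have [F lF FE] := factor _ _ cb.
pose Flin : {linear E -> E'} :=
  HB.pack F (GRing.isLinear.Build R E E' *:%R F lF).
(* Both sides are linear and agree on brackets, which span E. *)
have pF x : p' (F x) = p x.
  move: x; apply: spanE => [||x y]; try by move=> ? ? ?; rewrite ?lF linearP.
  by rewrite FE p'L !sK; case: cp => ->.
exists Flin; split=> [|g gL pg].
  by split=> // x y; rewrite /= FE; apply: lieE; rewrite pF sK.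
apply: spanE; try exact: linearP.
by move=> x y; rewrite /= gL FE; apply: lieE; rewrite ?sK pg.
Qed.

End Cocycles.

(** * Linear maps on the vector fields *)

Section Basis.
Variables (R : comNzRingType) (n : nat) (M : lmodType R).
Implicit Types (a : 'I_n) (r : 'X_{1..n}).

Lemma mpoly_linear_ext (f g : {mpoly R[n]} -> M) :
  linear f -> linear g -> (forall r, f 'X_[r] = g 'X_[r]) -> f =1 g.
Proof.
move=> lf lg fg p; elim/mpolyind: p => [|c r p _ _ IH].
  by rewrite !linear_map0.
by rewrite lf lg fg IH.
Qed.

Lemma freeg_linear_ext (f g : {freeg 'X_{1..n} / R} -> M) :
  linear f -> linear g -> (forall r, f << r >> = g << r >>) -> f =1 g.
Proof.
move=> lf lg fg w; elim/freeg_ind_dom0: w => [|c r w _ _ IH].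
  by rewrite !linear_map0.
by rewrite freegZU lf lg fg IH.
Qed.

(** The boolean selects the family, so that one statement covers both kinds of
basis elements. *)
Definition CW_basis (o : bool) a r : CW R n :=
  if o then CW_Gamma R a r else CW_G R a r.

Lemma CW_linear_ext (f g : CW R n -> M) : linear f -> linear g ->
  (forall o a r, f (CW_basis o a r) = g (CW_basis o a r)) -> f =1 g.
Proof.
move=> lf lg fg X.
have fgN o a r : f (- CW_basis o a r) = g (- CW_basis o a r).
  by rewrite (linear_mapN lf) (linear_mapN lg) fg.
have lin_pair (h : CW R n -> M) : linear h ->
    forall a, linear (fun p : {mpoly R[n]} => h (vf_dx (p, 0) a)) /\
              linear (fun w => h (vf_dx (0, w) a)).
  move=> lh a; split=> c u v; rewrite -lh -vf_dx_linear; congr (h (vf_dx _ a)).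
    by congr pair; rewrite /= scaler0 addr0.
  by congr pair; rewrite /= scaler0 addr0.
have fgdx u a : f (vf_dx u a) = g (vf_dx u a).
  have -> : u = (u.1, 0) + (0, u.2).
    by case: u => p w; congr pair; rewrite /= ?addr0 ?add0r.
  rewrite (linear_mapD (fun c => @vf_dx_linear R n a c)) (linear_mapD lf) (linear_mapD lg).
  congr (_ + _).
    move: u.1; apply: mpoly_linear_ext => [||r].
    - by have [] := lin_pair f lf a.
    - by have [] := lin_pair g lg a.
    - by have := fgN false a r; rewrite /CW_basis /CW_G opprK.
  move: u.2; apply: freeg_linear_ext => [||r].
  - by have [] := lin_pair f lf a.
  - by have [] := lin_pair g lg a.
  - by have := fgN true a r; rewrite /CW_basis /CW_Gamma opprK.
have -> : X = \sum_a vf_dx (X a) a.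
  apply/ffunP => b; rewrite sum_ffunE (bigD1 b) //= big1 => [|a /negPf ab].
    by rewrite ffunE eqxx addr0.
  by rewrite ffunE eq_sym ab.
rewrite (big_morph f (linear_mapD lf) (linear_map0 lf)).
rewrite (big_morph g (linear_mapD lg) (linear_map0 lg)).
by apply: eq_bigr => a _.
Qed.

Lemma CW_linear_map (v : bool -> 'I_n -> 'X_{1..n} -> M) :
  exists2 F : CW R n -> M, linear F & forall o a r, F (CW_basis o a r) = v o a r.
Proof.
pose F (X : CW R n) := - \sum_a (fglift (v false a) (X a).1 + fglift (v true a) (X a).2).
have lF : linear F.
  move=> c X Y; rewrite /F scalerN -opprD; congr (- _).
  rewrite scaler_sumr -big_split; apply: eq_bigr => a _ /=.
  by rewrite !ffunE scalerDr addrACA -!fglift_linear.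
exists F => // o a r.
have poly0 w : fglift w (0 : {mpoly R[n]}) = 0 :> M.
  apply: (linear_map0 (A := fun p : {mpoly R[n]} => fglift w p)) => c p q.
  by rewrite -fglift_linear.
have FN f : F (- vf_dx f a) = fglift (v false a) f.1 + fglift (v true a) f.2.
  rewrite (linear_mapN lF) /F opprK (bigD1 a) //= big1 => [|b /negPf ba].
    by rewrite ffunE eqxx addr0.
  by rewrite ffunE ba /= poly0 raddf0 addr0.
case: o; rewrite /CW_basis /CW_G /CW_Gamma FN /=.
  by rewrite poly0 liftU scale1r add0r.
by rewrite raddf0 addr0 unlock /mpolyX_def /= liftU scale1r.
Qed.

End Basis.

(** * The action of the torus *)

Section Torus.
Variables (R : comAlgType rat).
Implicit Types (M : lmodType R).

Lemma intr_mulVr (z : int) : z != 0 -> (z%:~R : rat)^-1%:A * z%:~R = 1 :> R.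
Proof.
move=> z0; rewrite mulr_algl -(rmorph_int (in_alg R)) /= scalerA mulVf ?scale1r //.
by rewrite intr_eq0.
Qed.

Lemma scalerz_inj M (z : int) : z != 0 -> injective (fun v : M => (z%:~R : R) *: v).
Proof.
move=> z0 u v /= /(congr1 ( *:%R ((z%:~R : rat)^-1%:A))).
by rewrite !scalerA intr_mulVr // !scale1r.
Qed.

Lemma scalern_inj M (k : nat) : (0 < k)%N -> injective (fun v : M => (k%:R : R) *: v).
Proof.
move=> k0 u v; rewrite -[k%:R]/(k%:Z%:~R); apply: scalerz_inj.
by rewrite eqz_nat -lt0n.
Qed.

Variable n : nat.
Implicit Types (a c j : 'I_n) (r s : 'X_{1..n}).

Local Notation G := (@CW_G R n).
Local Notation Gamma := (@CW_Gamma R n).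
Local Notation T j := (@CW_G R n j U_(j)).

(** The eigenvalue of [T j = - x_j d/dx_j], hence minus the degree in [x_j]; here
[Omega^r] has degree [- (r_j + 1)], like a negative power of [x_j]. *)
Definition weight (o : bool) a r j : int :=
  (j == a)%:Z + (if o then (r j).+1%:Z else - (r j)%:Z).

Lemma weight_GE a r j : (weight false a r j)%:~R = (j == a)%:R - (r j)%:R :> R.
Proof. by rewrite intrB. Qed.

Lemma weight_GammaE a r j :
  (weight true a r j)%:~R = (j == a)%:R + (r j).+1%:R :> R.
Proof. by rewrite intrD. Qed.

Lemma lie_torus o a r j :
  lie (T j) (CW_basis R o a r) = (weight o a r j)%:~R *: CW_basis R o a r.
Proof.
case: o.
  rewrite weight_GammaE scalerDl -[CW_basis R true a r]/(Gamma a r) lie_GGamma mnm1E.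
  congr (_ + _).
    have [->|] := eqVneq j a; last by rewrite !scale0r.
    by rewrite /CW_GammaB lem_addl addmK.
  by rewrite /CW_GammaB lem_addl addmK.
rewrite weight_GE scalerBl -[CW_basis R false a r]/(G a r) lie_GG mnm1E.
rewrite addmC addmK; have [->|] := eqVneq j a; last by rewrite !scale0r.
by rewrite addmK.
Qed.

Lemma weight_eq0 o a r : (forall j, weight o a r j = 0) -> o = false /\ r = U_(a)%MM.
Proof.
rewrite /weight; case: o => H; first by have := H a; case: eqP.
split=> //; apply/mnmP => j; have := H j; rewrite mnm1E eq_sym; case: eqP => _; lia.
Qed.

Lemma weight_torus a j : weight false a U_(a) j = 0.
Proof. by rewrite /weight mnm1E eq_sym; case: eqP. Qed.

Lemma lie_G0_G2 a : lie (G a 0%MM) (G a (U_(a) + U_(a))%MM) = - (2%:R *: T a).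
Proof.
by rewrite lie_GG mnm0E scale0r sub0r mnmDE mnm1E eqxx add0m addmK.
Qed.

Section Normalise.
Variables (M : lmodType R) (b : CW R n -> CW R n -> M).
Hypothesis cb : cocycle b.

Lemma cocycle_weight o a r o' a' r' j :
  (weight o a r j + weight o' a' r' j)%:~R *:
    b (CW_basis R o a r) (CW_basis R o' a' r')
  = b (T j) (lie (CW_basis R o a r) (CW_basis R o' a' r')).
Proof.
rewrite (cocycle_leibniz cb) !lie_torus (cocycleZl cb) (cocycleZr cb).
by rewrite -scalerDl -mulrzDr.
Qed.

Lemma cocycle_torus_exchange o a r i j :
  (weight o a r i)%:~R *: b (T j) (CW_basis R o a r)
  = (weight o a r j)%:~R *: b (T i) (CW_basis R o a r).
Proof.
have := cocycle_weight false i U_(i)%MM o a r j.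
by rewrite weight_torus add0r => ->; rewrite lie_torus (cocycleZr cb).
Qed.

(** [T j] is itself half a bracket of two vectors of opposite weights, on which
[cocycle_weight] reads [0 = b (T i, [_, _])]. *)
Lemma cocycle_torus2 i j : b (T i) (T j) = 0.
Proof.
have w a r : weight false a r i = (i == a)%:Z - (r i)%:Z by [].
have := cocycle_weight false j 0%MM false j (U_(j) + U_(j))%MM i.
rewrite /CW_basis lie_G0_G2 !w mnm0E mnmDE !mnm1E eq_sym.
have -> (e : bool) : e%:Z - 0%N%:Z + (e%:Z - (e + e)%N%:Z) = 0 by case: e.
rewrite scale0r (cocycleNr cb) (cocycleZr cb) => /esym/eqP.
by rewrite oppr_eq0 => /eqP Hz; apply: (@scalern_inj M 2) => //; rewrite Hz scaler0.
Qed.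

(** On a weight vector [v] with [lambda_j != 0] the first condition forces
[F v = lambda_j^-1 b (T_j, v)]; [cocycle_torus_exchange] makes this independent
of [j].  The weight zero space is the torus itself, where the first condition
is void by [cocycle_torus2] and the second one determines [F] by [lie_G0_G2]. *)
Lemma cocycle_normalise : exists2 F : CW R n -> M, linear F &
  (forall j X, F (lie (T j) X) = b (T j) X) /\
  (forall a, F (lie (G a 0%MM) (G a (U_(a) + U_(a))%MM))
             = b (G a 0%MM) (G a (U_(a) + U_(a))%MM)).
Proof.
have [F lF FE] := CW_linear_map (fun o a r =>
  if [pick j | weight o a r j != 0] is Some j
  then ((weight o a r j)%:~R : rat)^-1%:A *: b (T j) (CW_basis R o a r)
  else - (((2%:Z%:~R : rat)^-1%:A : R) *: b (G a 0%MM) (G a (U_(a) + U_(a))%MM))).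
exists F => //; split=> [j|a].
  apply: CW_linear_ext => [c X Y|c X Y|o a r].
  - by rewrite (cocycle_linr (lie_cocycle _)) lF.
  - exact: cocycle_linr cb _ _ _ _.
  rewrite lie_torus (linear_mapZ lF) FE; case: pickP => [i wi|w0].
    rewrite scalerA mulrC -scalerA -cocycle_torus_exchange scalerA intr_mulVr //.
    by rewrite scale1r.
  have [-> ->] : o = false /\ r = U_(a)%MM.
    by apply: weight_eq0 => i; apply/eqP; rewrite -[_ == _]negbK w0.
  by rewrite cocycle_torus2 weight_torus scale0r.
rewrite lie_G0_G2 (linear_mapN lF) (linear_mapZ lF) -[T a]/(CW_basis R false a U_(a)) FE.
case: pickP => [i|_].
  by rewrite weight_torus eqxx.
rewrite scalerN opprK scalerA mulrC.
by rewrite -[2%:R]/(2%:Z%:~R) intr_mulVr // scale1r.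
Qed.

End Normalise.
End Torus.

(** * Vanishing on pairs of opposite weights *)

Section OppositeWeights.
Variables (R : comAlgType rat) (n : nat).
Implicit Types (a c i j : 'I_n) (k r s p q : 'X_{1..n}).

Local Notation G := (@CW_G R n).
Local Notation Gamma := (@CW_Gamma R n).
Local Notation T j := (@CW_G R n j U_(j)).

(** The weights of [G^a_r] and [Gamma^c_k] add up to zero. *)
Definition opposite_weights a r c k : Prop :=
  forall j, (r j = (k j).+1 + (j == a) + (j == c))%N.

Lemma lie_GGamma_eq0 a c r k :
  ~~ (r <= k + U_(c))%MM -> ~~ (r <= k + U_(a))%MM -> lie (G a r) (Gamma c k) = 0.
Proof.
by rewrite lie_GGamma /CW_GammaB => /negPf -> /negPf ->; rewrite !scaler0 addr0.
Qed.

(** The bracket would be a combination of [Gamma]'s of weight zero, but all their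
weights are positive. *)
Lemma lie_GGamma_opposite a r c k :
  opposite_weights a r c k -> lie (G a r) (Gamma c k) = 0.
Proof.
move=> rE; apply: lie_GGamma_eq0; apply/negP.
  by move=> /mnm_lepP/(_ c); rewrite mnmDE mnm1E rE !eqxx; lia.
by move=> /mnm_lepP/(_ a); rewrite mnmDE mnm1E rE !eqxx; lia.
Qed.

Section Cocycle.
Variables (M : lmodType R) (b : CW R n -> CW R n -> M).
Hypothesis cb : cocycle b.

(** Choose a second index [i].  Moving the whole power of [x_i] out of [x^r] writes
[G^a_r] as a multiple of the bracket of [G^a_p] and [G^a_q].  Both kill
[Gamma^c_k]: the exponent of [x_i] in [x^p] and that of [x_a] in [x^q] are too
large. *)
Lemma cocycle_GGamma_opposite a r c k : (2 <= n)%N ->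
  opposite_weights a r c k -> b (G a r) (Gamma c k) = 0.
Proof.
move=> n2 rE.
have [i ia] : exists i, i != a.
  have [m mn mP] : exists2 m, (m < n)%N & m != a.
    by case: (eqVneq (a : nat) 0%N) => a0; [exists 1%N | exists 0%N];
      rewrite ?a0 // 1?eq_sym // (ltn_trans _ n2).
  by exists (Ordinal mn).
pose p := [multinom ((j == i) * r i)%N | j < n].
(* The exponent of x_a in q is raised by one because the bracket lowers it. *)
pose q := [multinom (if j == i then 0 else r j + (j == a))%N | j < n].
have lie_pq : lie (G a p) (G a q) = - ((r a).+1%:R *: G a r).
  rewrite lie_GG !mnmE eq_sym (negPf ia) mul0n eqxx scale0r sub0r addn1.
  congr (- (_ *: G a _)); apply/mnmP => j; rewrite mnmBE mnmDE !mnmE.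
  rewrite [a == j]eq_sym; case: (eqVneq j i) => [->|_] /=.
    by rewrite (negPf ia); lia.
  lia.
have [pc pa] : ~~ (p <= k + U_(c))%MM /\ ~~ (p <= k + U_(a))%MM.
  split; apply/negP => /mnm_lepP/(_ i); rewrite mnmDE mnm1E mnmE eqxx rE.
    by rewrite eq_sym (eq_sym c); lia.
  by rewrite (eq_sym a) (negPf ia); lia.
have [qc qa] : ~~ (q <= k + U_(c))%MM /\ ~~ (q <= k + U_(a))%MM.
  split; apply/negP => /mnm_lepP/(_ a);
    rewrite mnmDE mnm1E mnmE eq_sym (negPf ia) eqxx rE eqxx.
    by rewrite (eq_sym c); lia.
  by lia.
have := cocycle_leibniz cb (Gamma c k) (G a p) (G a q).
rewrite lie_pq !(cocycleC (lie_cocycle _) (Gamma c k)) !lie_GGamma_eq0 //.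
rewrite oppr0 (cocycle0l cb) (cocycle0r cb) addr0 (cocycleNr cb) (cocycleZr cb).
move=> /eqP; rewrite oppr_eq0 (cocycleC cb) scalerN oppr_eq0 => /eqP H.
by apply: (@scalern_inj R M (r a).+1) => //; rewrite H scaler0.
Qed.

Hypotheses (bT : forall j X, b (T j) X = 0)
  (bS : forall a, b (G a 0%MM) (G a (U_(a) + U_(a))%MM) = 0)
  (bO : forall a r c k, opposite_weights a r c k -> b (G a r) (Gamma c k) = 0).

Lemma normalised_cocycle_weight o a r o' a' r' j :
  weight o a r j + weight o' a' r' j != 0 ->
  b (CW_basis R o a r) (CW_basis R o' a' r') = 0.
Proof.
move=> wj; apply: (scalerz_inj wj).
by rewrite (cocycle_weight cb) bT scaler0.
Qed.

(** For [a != c], [G^c_(e_a + e_c)] is half of [[G^c_(2 e_c), G^c_(e_a)]], and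
[G^a_0] maps its two factors to [0] and to [- G^c_0]; this leaves the value on
[(G^c_0, G^c_(2 e_c))], which is zero by normalisation. *)
Lemma normalised_cocycle_G0 a c : b (G a 0%MM) (G c (U_(a) + U_(c))%MM) = 0.
Proof.
have [->//|ac] := eqVneq a c.
have lie1 : lie (G c U_(a)) (G c (U_(c) + U_(c))%MM) = - (2%:R *: G c (U_(a) + U_(c))%MM).
  by rewrite lie_GG mnmDE !mnm1E (negPf ac) eqxx scale0r sub0r addmA addmK.
have lie2 : lie (G a 0%MM) (G c U_(a)) = - G c 0%MM.
  by rewrite lie_GG mnm0E mnm1E eqxx scale0r sub0r scale1r addmK.
have lie3 : lie (G a 0%MM) (G c (U_(c) + U_(c))%MM) = 0.
  by rewrite lie_GG mnm0E mnmDE mnm1E eq_sym (negPf ac) !scale0r subr0.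
have := cocycle_leibniz cb (G a 0%MM) (G c U_(a)) (G c (U_(c) + U_(c))%MM).
rewrite lie1 lie2 lie3 (cocycleNl cb) bS (cocycle0r cb) oppr0 addr0.
rewrite (cocycleNr cb) (cocycleZr cb) => /eqP; rewrite oppr_eq0 => /eqP H.
by apply: (@scalern_inj R M 2) => //; rewrite H scaler0.
Qed.

(** [G^c_(e_a)] is half of [[G^c_(2 e_a), G^a_0]], which reduces the claim to pairs
with first entry [G^a_0]. *)
Lemma normalised_cocycle_gl a c : b (G a U_(c)) (G c U_(a)) = 0.
Proof.
have [->//|ac] := eqVneq a c.
have lie1 : lie (G a 0%MM) (G c (U_(a) + U_(a))%MM) = - (2%:R *: G c U_(a)).
  by rewrite lie_GG mnm0E mnmDE mnm1E eqxx scale0r sub0r add0m addmK.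
have lie2 : lie (G a U_(c)) (G a 0%MM) = 0.
  by rewrite lie_GG mnm0E mnm1E eq_sym (negPf ac) !scale0r subr0.
have lie3 : lie (G a U_(c)) (G c (U_(a) + U_(a))%MM) =
    G a (U_(a) + U_(a))%MM - 2%:R *: G c (U_(a) + U_(c))%MM.
  rewrite lie_GG mnmDE !mnm1E !eqxx scale1r [(U_(c) + _)%MM]addmC addmK.
  by rewrite -addmA [(U_(a) + U_(c))%MM]addmC addmA addmK [(U_(c) + _)%MM]addmC.
have := cocycle_leibniz cb (G a U_(c)) (G a 0%MM) (G c (U_(a) + U_(a))%MM).
rewrite lie1 lie2 lie3 (cocycle0l cb) add0r (cocycleBr cb) bS (cocycleZr cb).
rewrite normalised_cocycle_G0 scaler0 subr0 (cocycleNr cb) (cocycleZr cb).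
move=> /eqP; rewrite oppr_eq0 => /eqP H.
by apply: (@scalern_inj R M 2) => //; rewrite H scaler0.
Qed.

Lemma mnm_add_eq2 a c r s : (r + s = U_(a) + U_(c))%MM ->
  [\/ r = 0%MM /\ s = (U_(a) + U_(c))%MM,
      s = 0%MM /\ r = (U_(a) + U_(c))%MM,
      r = U_(a)%MM /\ s = U_(c)%MM | r = U_(c)%MM /\ s = U_(a)%MM].
Proof.
move=> rs; have E j : (r j + s j = (a == j) + (c == j))%N.
  by rewrite -!mnmDE rs mnmDE !mnm1E.
have ext (u v : 'X_{1..n}) : (forall j, u j = v j) -> u = v by move=> ?; apply/mnmP.
have := E a; have := E c; rewrite !eqxx (eq_sym c a).
have [ac|ac] /= := eqVneq a c.
  rewrite -{}ac in E *.
  case ra : (r a) => [|[|m]] Ea _; [constructor 1|constructor 3|constructor 2]; split;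
   apply: ext => j; have := E j; rewrite ?mnmDE ?mnm0E ?mnm1E;
   case: eqP => [<-|_]; rewrite ?ra; lia.
case ra : (r a) => [|m] Ec Ea; case rc: (r c) => [|m'];
  [constructor 1|constructor 4|constructor 3|constructor 2]; split;
  apply: ext => j; have := E j; rewrite ?mnmDE ?mnm0E ?mnm1E;
  case: (eqVneq a j) => [aj|_]; case: (eqVneq c j) => [cj|_];
  subst=> /=; rewrite ?ra ?rc; lia.
Qed.

Lemma normalised_cocycle_eq0 X Y : b X Y = 0.
Proof.
have l0 (V W : lmodType R) : linear (fun _ : V => 0 : W) by move=> ? ? ?; rewrite scaler0 addr0.
move: X; apply: CW_linear_ext; [exact: cocycle_linl cb Y|exact: l0|].
move=> o a r; move: Y; apply: CW_linear_ext; [exact: cocycle_linr|exact: l0|].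
move=> o' c s.
case: (pickP (fun j => weight o a r j + weight o' c s j != 0)) => [j|w0].
  exact: normalised_cocycle_weight.
have {}w0 j : weight o a r j + weight o' c s j = 0.
  by apply/eqP; rewrite -[_ == _]negbK w0.
case: o o' w0 => [] [] w0; rewrite /CW_basis.
- by have := w0 a; rewrite /weight; lia.
- rewrite (cocycleC cb) bO ?oppr0 // => j.
  by have := w0 j; rewrite /weight; lia.
- by rewrite bO // => j; have := w0 j; rewrite /weight; lia.
have : (r + s = U_(a) + U_(c))%MM.
  apply/mnmP => j; rewrite !mnmDE !mnm1E (eq_sym a) (eq_sym c).
  by have := w0 j; rewrite /weight; lia.
case/mnm_add_eq2 => -[-> ->].
- exact: normalised_cocycle_G0.
- by rewrite (cocycleC cb) addmC normalised_cocycle_G0 oppr0.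
- exact: bT.
- exact: normalised_cocycle_gl.
Qed.

End Cocycle.

Lemma cocycle_coboundary (M : lmodType R) (b : CW R n -> CW R n -> M) :
  cocycle b ->
  (forall a r c k, opposite_weights a r c k -> b (G a r) (Gamma c k) = 0) ->
  exists2 F : CW R n -> M, linear F & forall X Y, F (lie X Y) = b X Y.
Proof.
move=> cb bO; have [F lF [FT FS]] := cocycle_normalise cb; exists F => // X Y.
have cF := cocycle_comp (lie_cocycle (CW R n)) lF.
apply/esym/eqP; rewrite -subr_eq0; apply/eqP.
apply: (normalised_cocycle_eq0 (cocycleB cb cF)) => [j Z|a|a r c k ark].
- by rewrite FT subrr.
- by rewrite FS subrr.
- by rewrite bO // lie_GGamma_opposite // (linear_map0 lF) subrr.
Qed.

(** A vector of nonzero weight is a multiple of its bracket with some [T j], and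
[T a] is half of [[G^a_(2 e_a), G^a_0]]. *)
Lemma CW_bracket_spanned : bracket_spanned (CW R n).
Proof.
move=> V f g lf lg fg; apply: CW_linear_ext => // o a r.
case: (pickP (fun j => weight o a r j != 0)) => [j wj|w0].
  apply: (scalerz_inj wj); rewrite /= -(linear_mapZ lf) -(linear_mapZ lg).
  by rewrite -lie_torus fg.
have [-> ->] : o = false /\ r = U_(a)%MM.
  by apply: weight_eq0 => i; apply/eqP; rewrite -[_ == _]negbK w0.
have := fg (G a 0%MM) (G a (U_(a) + U_(a))%MM).
rewrite lie_G0_G2 (linear_mapN lf) (linear_mapN lg) (linear_mapZ lf) (linear_mapZ lg).
by move=> /oppr_inj/scalern_inj->.
Qed.

End OppositeWeights.

(** * The residue cocycle on [CW_1] *)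

Section Residue.
Variables (R : comNzRingType) (n : nat).

Definition residue (f : kpoly R n) : R^o := coeff 0%MM f.2.

Lemma residue_linear : linear residue.
Proof. by move=> c f g; rewrite /residue /= coeffD coeffZ. Qed.

Lemma residue_xmon r : residue (xmon R r) = 0.
Proof. by rewrite /residue coeff0. Qed.

Lemma residue_Omon r : residue (Omon R r) = (r == 0%MM)%:R.
Proof. by rewrite /residue coeffU mul1r. Qed.

(** A derivative of [Omega^k] is a multiple of [Omega^(k + e_a)], never of
[Omega^0]. *)
Lemma residue_kderiv a (f : kpoly R n) : residue (kderiv a f) = 0.
Proof.
rewrite /residue /=; move: f.2.
apply: (@freeg_linear_ext R n R^o (fun w => coeff 0%MM (omega_deriv a w)) (fun => 0)).
- by move=> c v w; rewrite omega_deriv_linear coeffD coeffZ.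
- by move=> c v w; rewrite scaler0 addr0.
move=> k; rewrite omega_derivU coeffN coeffZ coeffU.
have -> : (k + U_(a) == 0)%MM = false.
  by apply/eqP => /mnmP/(_ a); rewrite mnmDE mnm1E mnm0E eqxx addn1.
by rewrite mulr0 mulr0 oppr0.
Qed.

End Residue.

Section Witt1.
Variable R : comAlgType rat.

Local Notation D := (@kderiv R 1 ord0).

Lemma lie_CW1E (X Y : CW R 1) :
  lie X Y ord0 = X ord0 * D (Y ord0) - Y ord0 * D (X ord0).
Proof. by rewrite ffunE /vf_act !big_ord1. Qed.

(** The factor 1/6 makes the value on [(G_(s+3), Gamma_s)] a binomial
coefficient: the third derivative of [x^r] is [r (r - 1) (r - 2) x^(r - 3)]. *)
Definition CW1_cocycle (X Y : CW R 1) : R^o :=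
  (6%:Z%:~R : rat)^-1%:A *: residue (D (D (D (X ord0))) * Y ord0).

(** Integration by parts: [2 f''' f = (2 f'' f - f' f')'], and the cyclic sum of
[f''' (g h' - h g')] is the derivative of the cyclic sum of
[f'' (g h' - h g')], as the cyclic sum of [f'' (g h'' - h g'')] cancels. *)
Lemma CW1_cocycleP : cocycle CW1_cocycle.
Proof.
have DB f g : D (f - g) = D f - D g by rewrite linearB.
have DD f g : D (f + g) = D f + D g by rewrite linearD.
pose b (X Y : CW R 1) : R^o := residue (D (D (D (X ord0))) * Y ord0).
have addE c (X Y : CW R 1) : (c *: X + Y) ord0 = c *: X ord0 + Y ord0.
  by rewrite !ffunE.
apply: (@cocycle_comp R (CW R 1) R^o R^o b); last first.
  by move=> c u v; rewrite scalerDr !scalerA mulrC.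
split.
- by move=> Y c X X'; rewrite /b addE !linearP mulrDl -scalerAl residue_linear.
- by move=> X c Y Y'; rewrite /b addE mulrDr -scalerAr residue_linear.
- move=> X; rewrite /b; set f := X ord0.
  have E : 2%:R *: (D (D (D f)) * f) = D (2%:R * (D (D f) * f) - D f * D f).
    rewrite DB mulrDl mul1r DD !kderivM scaler_nat; ring.
  apply: (@scalern_inj R R^o 2) => //; rewrite /= scaler0.
  by rewrite -(linear_mapZ (@residue_linear R 1)) E residue_kderiv.
move=> X Y Z; rewrite /b !lie_CW1E.
set f := X ord0; set g := Y ord0; set h := Z ord0.
rewrite -!(linear_mapD (@residue_linear R 1)).
transitivity (residue (D (D (D f) * (g * D h - h * D g) +
  D (D g) * (h * D f - f * D h) + D (D h) * (f * D g - g * D f)))).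
  by congr residue; rewrite !(DB, DD, kderivM); ring.
exact: residue_kderiv.
Qed.

Lemma CW1_G_ord0 r : CW1_G R r ord0 = - xmon R [multinom r | i < 1].
Proof. by rewrite !ffunE eqxx. Qed.

Lemma CW1_Gamma_ord0 s : CW1_Gamma R (Posz s) ord0 = - Omon R [multinom s | i < 1].
Proof. by rewrite !ffunE eqxx. Qed.

Lemma kderiv_x1 r :
  D (xmon R [multinom r | i < 1]) = r%:R *: xmon R [multinom r.-1 | i < 1].
Proof.
rewrite kderiv_x mnmE; congr (_ *: xmon R _); apply/mnmP => i.
by rewrite [i]ord1 mnmBE !mnmE eqxx subn1.
Qed.

Lemma CW1_cocycle_G r Y : CW1_cocycle (CW1_G R r) Y =
  - ((6%:Z%:~R : rat)^-1%:A *: ((r * r.-1 * r.-2)%:R *: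
      residue (xmon R [multinom r.-1.-2 | i < 1] * Y ord0))).
Proof.
rewrite /CW1_cocycle CW1_G_ord0 -scaleN1r !(linear_mapZ (@kderiv_linear R 1 ord0)).
rewrite kderiv_x1 !(linear_mapZ (@kderiv_linear R 1 ord0)) kderiv_x1.
rewrite (linear_mapZ (@kderiv_linear R 1 ord0)) kderiv_x1 !scalerA -scalerAl.
by rewrite (linear_mapZ (@residue_linear R 1)) mulN1r !mulNr -!natrM scaleNr scalerN scalerA.
Qed.

Lemma CW1_cocycle_GG r s : CW1_cocycle (CW1_G R r) (CW1_G R s) = 0.
Proof.
rewrite CW1_cocycle_G CW1_G_ord0 mulrN mul_xx (linear_mapN (@residue_linear R 1)).
by rewrite residue_xmon oppr0 !scaler0 oppr0.
Qed.

Lemma CW1_cocycle_GammaGamma (r s : nat) :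
  CW1_cocycle (CW1_Gamma R r) (CW1_Gamma R s) = 0.
Proof.
have OD k : D (Omon R k) = - (k ord0).+1%:R *: Omon R (k + U_(ord0))%MM.
  by rewrite kderiv_O scaleNr.
rewrite /CW1_cocycle !CW1_Gamma_ord0 -!scaleN1r.
rewrite !(linear_mapZ (@kderiv_linear R 1 ord0)) OD.
rewrite !(linear_mapZ (@kderiv_linear R 1 ord0)) OD.
rewrite (linear_mapZ (@kderiv_linear R 1 ord0)) OD -!scalerAl -!scalerAr mul_OO.
by rewrite !scaler0 (linear_map0 (@residue_linear R 1)) scaler0.
Qed.

Lemma CW1_cocycle_GGamma (r s : nat) :
  CW1_cocycle (CW1_G R r) (CW1_Gamma R s) =
  (r == s + 3)%N%:R * 'C(s + 3, 3)%:R.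
Proof.
rewrite CW1_cocycle_G CW1_Gamma_ord0 mulrN (linear_mapN (@residue_linear R 1)) !scalerN opprK.
have [->|nrs] := eqVneq r (s + 3)%N.
  have -> : ((s + 3).-1.-2 = s)%N by lia.
  rewrite mul1r mul_xO lepm_refl -{1}[[multinom s | _ < 1]]add0m addmK residue_Omon eqxx.
  have -> : ((s + 3) * (s + 3).-1 * (s + 3).-2 = 6 * 'C(s + 3, 3))%N.
    by have := bin_ffact (s + 3) 3; rewrite mulnC => ->; rewrite !ffactnS ffactn0; lia.
  by rewrite scalerA natrM mulrA -[6%:R]/(6%:Z%:~R) intr_mulVr // mul1r; exact: mulr1.
rewrite mul0r mul_xO; case: ifP => [/mnm_lepP/(_ ord0)|_]; last first.
  by rewrite (linear_map0 (@residue_linear R 1)) !scaler0.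
rewrite !mnmE residue_Omon; case: eqP => [/mnmP/(_ ord0)|_]; last by rewrite !scaler0.
rewrite mnmBE !mnmE => E1 E2.
have -> : (r * r.-1 * r.-2 = 0)%N.
  by case: r nrs E1 E2 => [|[|[|r]]] //=; lia.
by rewrite scale0r scaler0.
Qed.

Variables (M : lmodType R) (b : CW R 1 -> CW R 1 -> M).
Hypothesis cb : cocycle b.

(** [G_(k+4)] commutes with [Gamma_k], so the cocycle identity for [G_0],
[G_(k+4)] and [Gamma_k] gives [(k + 1) u_(k+1) = (k + 4) u_k], where
[u_k = b (G_(k+3), Gamma_k)]. *)
Lemma cocycle_CW1_opposite k :
  b (CW1_G R (k + 3)) (CW1_Gamma R k) =
  'C(k + 3, 3)%:R *: b (CW1_G R 3) (CW1_Gamma R 0).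
Proof.
elim: k => [|k IH]; first by rewrite scale1r.
have GG : lie (CW1_G R 0) (CW1_G R (k + 4)) = - ((k + 4)%:R *: CW1_G R (k + 3)).
  rewrite lie_GG !mnmE scale0r sub0r; congr (- (_ *: CW_G R _ _)).
  by apply/mnmP => i; rewrite [i]ord1 mnmBE mnmDE !mnmE eqxx; lia.
have := cocycle_leibniz cb (CW1_G R 0) (CW1_G R (k + 4)) (CW1_Gamma R k).
rewrite GG !lie_CW1_GGamma.
have -> : k%:Z - (k + 4)%N%:Z + 1 = Negz 2 by lia.
have -> : k%:Z - 0%N%:Z + 1 = k.+1 by lia.
rewrite scaler0 (cocycle0r cb) (cocycleNl cb) (cocycleZl cb) (cocycleZr cb) IH.
rewrite addrC => /esym/subr0_eq E.
apply: (@scalern_inj R M k.+1) => //=.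
rewrite add0n addn1 in E; rewrite addSnnS E !scalerA -!natrM.
have := mul_bin_down (k + 4) 3; rewrite [(k + 4)%N]addnS /= => ->.
by congr ((_ * _)%:R *: _); lia.
Qed.

End Witt1.

(** * The universal central extensions *)

Lemma mnm1_const (r : 'X_{1..1}) : r = [multinom r ord0 | _ < 1].
Proof. by apply/mnmP => i; rewrite mnmE ord1. Qed.

Section Universal.
Variable R : comAlgType rat.

Definition CW1_tilde : lieAlgebra R :=
  LieAlgebra (extension_axioms (CW1_cocycleP R)).

Lemma CW1_tilde_bracketE (X Y : CW R 1) (s t : R^o) :
  lie ((X, s) : CW1_tilde) (Y, t) = (lie X Y, CW1_cocycle X Y) :> CW1_tilde.
Proof. by []. Qed.

Lemma lie_G3_Gamma0 : lie (CW1_G R 3) (CW1_Gamma R 0) = 0 /\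
  CW1_cocycle (CW1_G R 3) (CW1_Gamma R 0) = 1.
Proof.
by rewrite lie_CW1_GGamma CW1_cocycle_GGamma eqxx mulr1 scaler0.
Qed.

(** The central element is the bracket of [G_3] and [Gamma_0]; modulo it,
perfectness is that of [CW_1]. *)
Lemma CW1_tilde_bracket_spanned : bracket_spanned CW1_tilde.
Proof.
move=> V f g lf lg fg.
have fg1 : f (0, 1) = g (0, 1).
  have := fg (CW1_G R 3, 0) (CW1_Gamma R 0, 0).
  by rewrite CW1_tilde_bracketE; case: lie_G3_Gamma0 => -> ->.
have fgX X : f (X, 0) = g (X, 0).
  have pairP c (X' Y' : CW R 1) : (c *: X' + Y', 0) = c *: (X', 0) + (Y', 0) :> CW1_tilde.
    by congr pair; rewrite /= scaler0 addr0.
  move: X; apply: CW_bracket_spanned => [c X Y|c X Y|X Y].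
  - by rewrite pairP lf.
  - by rewrite pairP lg.
  have hE (h : CW1_tilde -> V) : linear h -> h (lie X Y, 0) =
      h (lie ((X, 0) : CW1_tilde) (Y, 0)) - CW1_cocycle X Y *: h (0, 1).
    move=> lh; rewrite -(linear_mapZ lh) -(linear_mapB lh) CW1_tilde_bracketE.
    congr h; congr pair; rewrite /= ?scaler0 ?subr0 //.
    by rewrite [_ *: _]mulr1 subrr.
  by rewrite (hE f lf) (hE g lg) fg fg1.
move=> [X t]; have -> : (X, t) = (X, 0) + t *: (0, 1) :> CW1_tilde.
  by congr pair; rewrite /= ?scaler0 ?addr0 // add0r [_ *: _]mulr1.
by rewrite (linear_mapD lf) (linear_mapD lg) (linear_mapZ lf) (linear_mapZ lg) fgX fg1.
Qed.

(** Subtracting [u] times the residue cocycle, with [u = b (G_3, Gamma_0)], makes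
[b] vanish on all pairs of opposite weights; the central element of the
extension is then sent to [u]. *)
Lemma CW1_tilde_universal :
  @universal_central_extension R CW1_tilde (CW R 1) fst.
Proof.
apply: universal_central_extensionI CW1_tilde_bracket_spanned _.
  split=> [[X s] [Y t]|y|[Z s] Z0 [X t]]; first by rewrite CW1_tilde_bracketE.
    by exists (y, 0).
  rewrite CW1_tilde_bracketE; move: Z0 => /= ->.
  congr pair; first exact: cocycle0l (lie_cocycle (CW R 1)) X.
  exact: cocycle0l (CW1_cocycleP R) X.
move=> M b cb; pose u := b (CW1_G R 3) (CW1_Gamma R 0).
have lu : linear (fun t : R^o => t *: u).
  by move=> c t t'; rewrite scalerDl scalerA.
have cu := cocycle_comp (CW1_cocycleP R) lu.
have [a r c k ark|F lF FE] := cocycle_coboundary (cocycleB cb cu).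
  have [a0 c0] : a = ord0 /\ c = ord0 by rewrite !ord1.
  subst a c; rewrite (mnm1_const r) (mnm1_const k).
  have -> : r ord0 = (k ord0 + 3)%N by rewrite ark eqxx; lia.
  have := cocycle_CW1_opposite cb (k ord0).
  have := CW1_cocycle_GGamma R (k ord0 + 3) (k ord0).
  rewrite /CW1_G /CW1_Gamma eqxx mul1r => -> ->.
  by rewrite subrr.
exists (fun v => F v.1 + v.2 *: u) => [t v w|[X s] [Y t]].
  by rewrite /= lF scalerDl scalerDr scalerA addrACA.
by rewrite CW1_tilde_bracketE [LHS]/(F (lie X Y) + _) FE; exact: subrK.
Qed.

Lemma CW_centrally_closed n : (2 <= n)%N -> centrally_closed (CW R n).
Proof.
move=> n2; apply: universal_central_extensionI (@CW_bracket_spanned R n) _.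
  split=> [//|y|z /= -> x]; first by exists y.
  exact: cocycle0l (lie_cocycle (CW R n)) x.
move=> M b cb; apply: cocycle_coboundary => // a r c k.
exact: cocycle_GGamma_opposite.
Qed.

End Universal.

Theorem lemma4p2p1 (R : comAlgType rat) :
  (exists (br : CW R 1 * R^o -> CW R 1 * R^o -> CW R 1 * R^o)
          (brP : lie_axioms br),
    [/\ forall r s : nat,
          br (CW1_G R r, 0) (CW1_G R s, 0) = (lie (CW1_G R r) (CW1_G R s), 0),
        forall r s : nat,
          br (CW1_Gamma R r, 0) (CW1_Gamma R s, 0)
          = (lie (CW1_Gamma R r) (CW1_Gamma R s), 0),
        forall r s : nat,
          br (CW1_G R r, 0) (CW1_Gamma R s, 0)
          = (r + s + 1)%:R *: (CW1_Gamma R (s%:Z - r%:Z + 1), 0)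
            + ((r == s + 3)%N%:R * 'C(s + 3, 3)%:R) *: (0, 1),
        forall v, br (0, 1) v = 0
      & @universal_central_extension R (LieAlgebra brP) (CW R 1) fst]) /\
  forall n : nat, (2 <= n)%N -> centrally_closed (CW R n).
Proof.
split; last exact: CW_centrally_closed.
exists (extension_bracket (@CW1_cocycle R)), (extension_axioms (CW1_cocycleP R)).
split=> [r s|r s|r s|v|]; last exact: CW1_tilde_universal.
- by rewrite /extension_bracket CW1_cocycle_GG.
- by rewrite /extension_bracket CW1_cocycle_GammaGamma.
- rewrite /extension_bracket lie_CW1_GGamma CW1_cocycle_GGamma.
  by congr pair; rewrite /= !scaler0 ?addr0 // add0r; apply/esym/mulr1.
- congr pair; first exact: cocycle0l (lie_cocycle (CW R 1)) v.1.
  exact: cocycle0l (CW1_cocycleP R) v.1.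
Qed.
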